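(* Let $H$ be a $\circ$-Hopf algebra with antipode $S$, and let $(V,\chi)$ be a finite dimensional right $H$-comodule such that $V$ as well as $V^*$ admit unitary inner products; let $\beta$ be a unitary inner product on $V$. Then there is an isomorphism of right $H$-comodules from $(V,\chi)$ to $(V,(\mathrm{id}\otimes S^2)\chi)$ that is positive definite (with respect to $\beta$).
   Context: Everything is over $\mathbb{C}$. A $\circ$-structure on a coalgebra $C$ is a conjugate linear involution $c\mapsto c^\circ$ with $\Delta(c^\circ)=\sum c_2^\circ\otimes c_1^\circ$. A $\circ$-Hopf algebra is a Hopf algebra $H$ with a $\circ$-structure on its underlying coalgebra such that $(xy)^\circ=x^\circ y^\circ$ for all $x,y\in H$ (the antipode $S$ is then bijective, with $S^{-1}=\circ S\circ$). For a right $H$-comodule $(V,\chi)$ write $\chi(v)=\sum v_0\otimes v_1$. A unitary inner product on $V$ is an inner product $\beta$ (linear in the first, conjugate linear in the second variable) with $\sum\beta(u_0,v)u_1=\sum\beta(u,v_0)v_1^\circ$ for all $u,v\in V$. For finite dimensional $V$, the dual $V^*$ is a right $H$-comodule via $f\mapsto\sum f_0\otimes f_1$ determined by $\sum f_0(v)f_1=\sum f(v_0)S(v_1)$ for all $v\in V$. A linear map $\phi:V\to V$ is positive definite with respect to $\beta$ if $\beta(\phi(v),v)>0$ for all $0\ne v\in V$. *)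

(* Defs.v *)
From HB Require Import structures.
From mathcomp Require Import all_boot all_order all_algebra.
From mathcomp Require Import boolp reals complex.

Set Implicit Arguments.
Unset Strict Implicit.
Unset Printing Implicit Defensive.

Import Order.TTheory GRing.Theory Num.Theory.
Local Open Scope ring_scope.
Local Open Scope quotient_scope.

Reserved Notation "u ⊗ v" (at level 40, left associativity).
Reserved Notation "\tsum_ ( x , y <- t ) F"
  (at level 41, x name, y name, F at level 41,
   format "\tsum_ ( x ,  y  <-  t )  F").

(* Tensor products over a commutative ring. A formal finite sum of pure       *)
(* tensors is a list of pairs; two of them are identified when no balanced    *)
(* biadditive map into an abelian group separates them. The universal         *)
(* property is [tlift_tens] (existence) with [tensor_ext] (uniqueness).       *)
Section Tensor.
Variables (R : comNzRingType) (U V : lmodType R).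

Record balanced (W : zmodType) (b : U -> V -> W) : Prop := Balanced {
  balancedDl : forall u u' v, b (u + u') v = b u v + b u' v;
  balancedDr : forall u v v', b u (v + v') = b u v + b u v';
  balancedZ : forall a u v, b (a *: u) v = b u (a *: v)
}.

Definition tensor_equiv (s t : seq (U * V)) : bool :=
  `[< forall (W : zmodType) (b : U -> V -> W), balanced b ->
      \sum_(p <- s) b p.1 p.2 = \sum_(p <- t) b p.1 p.2 >].

Lemma tensor_equiv_is_equiv : equiv_class_of tensor_equiv.
Proof.
split=> [s|s t|t s r].
- by apply/asboolP.
- by apply/asboolP/asboolP => st W b bb; rewrite st.
- move=> /asboolP st /asboolP tr; apply/asboolP => W b bb.
  by rewrite st // tr.
Qed.

Canonical tensor_equiv_rel := EquivRelPack tensor_equiv_is_equiv.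
Canonical tensor_encModRel := defaultEncModRel tensor_equiv.

Definition tensor : Type := {eq_quot tensor_equiv}.

HB.instance Definition _ : EqQuotient _ tensor_equiv tensor :=
  EqQuotient.on tensor.
HB.instance Definition _ := Choice.on tensor.

Lemma tensor_piP (s t : seq (U * V)) :
  (\pi_tensor s = \pi_tensor t) <->
  (forall (W : zmodType) (b : U -> V -> W), balanced b ->
      \sum_(p <- s) b p.1 p.2 = \sum_(p <- t) b p.1 p.2).
Proof.
split=> [/eqP | st]; first by rewrite piE => /asboolP.
by apply/eqP; rewrite piE; apply/asboolP.
Qed.

Lemma tensor_reprP (s : seq (U * V)) (W : zmodType) (b : U -> V -> W) :
  balanced b ->
  \sum_(p <- repr (\pi_tensor s)) b p.1 p.2 = \sum_(p <- s) b p.1 p.2.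
Proof. by move: W b; apply/tensor_piP; rewrite reprK. Qed.

Definition tensor_zero : tensor := \pi_tensor [::].
Definition tensor_add (t t' : tensor) : tensor :=
  \pi_tensor (repr t ++ repr t').
Definition tensor_scale (a : R) (t : tensor) : tensor :=
  \pi_tensor [seq (a *: p.1, p.2) | p <- repr t].
Definition tensor_opp (t : tensor) : tensor := tensor_scale (-1) t.

Lemma balanced0l (W : zmodType) (b : U -> V -> W) v : balanced b -> b 0 v = 0.
Proof. by move=> bb; apply: (addIr (b 0 v)); rewrite -balancedDl // !add0r. Qed.

Lemma balancedNl (W : zmodType) (b : U -> V -> W) u v :
  balanced b -> b (- u) v = - b u v.
Proof.
move=> bb; apply/eqP; rewrite -addr_eq0 -balancedDl //.
by rewrite addNr balanced0l.
Qed.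

Lemma balanced_scale (W : zmodType) (b : U -> V -> W) a :
  balanced b -> balanced (fun u v => b (a *: u) v).
Proof.
move=> bb; split=> [u u' v|u v v'|c u v].
- by rewrite scalerDr balancedDl.
- by rewrite balancedDr.
- by rewrite !balancedZ // !scalerA mulrC.
Qed.

Let repr_add t t' (W : zmodType) (b : U -> V -> W) : balanced b ->
  \sum_(p <- repr (tensor_add t t')) b p.1 p.2
  = \sum_(p <- repr t) b p.1 p.2 + \sum_(p <- repr t') b p.1 p.2.
Proof. by move=> bb; rewrite tensor_reprP // big_cat. Qed.

Let repr_scale a t (W : zmodType) (b : U -> V -> W) : balanced b ->
  \sum_(p <- repr (tensor_scale a t)) b p.1 p.2
  = \sum_(p <- repr t) b (a *: p.1) p.2.
Proof. by move=> bb; rewrite tensor_reprP // big_map. Qed.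

Let tensor_eq (t t' : tensor) :
  (forall (W : zmodType) (b : U -> V -> W), balanced b ->
      \sum_(p <- repr t) b p.1 p.2 = \sum_(p <- repr t') b p.1 p.2) ->
  t = t'.
Proof. by move=> /tensor_piP; rewrite !reprK. Qed.

Fact tensor_addA : associative tensor_add.
Proof. by move=> x y z; apply: tensor_eq => W b bb; rewrite !repr_add ?addrA. Qed.

Fact tensor_addC : commutative tensor_add.
Proof. by move=> x y; apply: tensor_eq => W b bb; rewrite !repr_add 1?addrC. Qed.

Fact tensor_add0 : left_id tensor_zero tensor_add.
Proof.
by move=> x; apply: tensor_eq => W b bb; rewrite repr_add // tensor_reprP // big_nil add0r.
Qed.

Fact tensor_addN : left_inverse tensor_zero tensor_opp tensor_add.
Proof.
move=> x; apply: tensor_eq => W b bb.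
rewrite repr_add // repr_scale // tensor_reprP // big_nil -big_split big1 //=.
by move=> p _; rewrite scaleN1r balancedNl // addNr.
Qed.

HB.instance Definition _ :=
  GRing.isZmodule.Build tensor tensor_addA tensor_addC tensor_add0 tensor_addN.

Fact tensor_scaleA a b t :
  tensor_scale a (tensor_scale b t) = tensor_scale (a * b) t.
Proof.
apply: tensor_eq => W f bf; rewrite !repr_scale //.
rewrite (repr_scale b t (balanced_scale a bf)).
by apply: eq_bigr => p _; rewrite scalerA mulrC.
Qed.

Fact tensor_scale1 : left_id 1 tensor_scale.
Proof.
move=> t; apply: tensor_eq => W f bf; rewrite repr_scale //.
by apply: eq_bigr => p _; rewrite scale1r.
Qed.

Fact tensor_scaleDr : right_distributive tensor_scale +%R.
Proof.
move=> a t t'; apply: tensor_eq => W f bf.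
have bfa := balanced_scale a bf.
by rewrite repr_scale // (repr_add _ _ bfa) repr_add // !repr_scale.
Qed.

Fact tensor_scaleDl t : {morph tensor_scale^~ t : a b / a + b}.
Proof.
move=> a b; apply: tensor_eq => W f bf.
rewrite repr_add // !repr_scale // -big_split.
by apply: eq_bigr => p _; rewrite scalerDl balancedDl.
Qed.

HB.instance Definition _ := GRing.Zmodule_isLmodule.Build R tensor
  tensor_scaleA tensor_scale1 tensor_scaleDr tensor_scaleDl.

Definition tens (u : U) (v : V) : tensor := \pi_tensor [:: (u, v)].

(* The Sweedler sum [Σ b(t_1, t_2)], where [t = Σ t_1 ⊗ t_2]. A representative *)
(* of [t] is chosen, so this is meaningful for balanced [b] only.             *)
Definition tlift (W : zmodType) (t : tensor) (b : U -> V -> W) : W :=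
  \sum_(p <- repr t) b p.1 p.2.

Lemma tlift_tens (W : zmodType) (b : U -> V -> W) u v :
  balanced b -> tlift (tens u v) b = b u v.
Proof. by move=> bb; rewrite /tlift tensor_reprP // big_seq1. Qed.

Lemma tlift_is_additive (W : zmodType) (b : U -> V -> W) t t' :
  balanced b -> tlift (t + t') b = tlift t b + tlift t' b.
Proof. exact: repr_add. Qed.

Lemma tlift0 (W : zmodType) (b : U -> V -> W) : balanced b -> tlift 0 b = 0.
Proof.
by move=> bb; apply: (addIr (tlift 0 b)); rewrite -tlift_is_additive // !add0r.
Qed.

Lemma tlift_sum (W : zmodType) (b : U -> V -> W) I (r : seq I) (P : pred I)
    (F : I -> tensor) : balanced b ->
  tlift (\sum_(i <- r | P i) F i) b = \sum_(i <- r | P i) tlift (F i) b.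
Proof.
move=> bb; apply: (big_morph (fun t => tlift t b)) => [t t'|].
  exact: tlift_is_additive.
exact: tlift0.
Qed.

Lemma tliftZ (W : lmodType R) (b : U -> V -> W) a t :
    balanced b -> (forall u v, b (a *: u) v = a *: b u v) ->
  tlift (a *: t) b = a *: tlift t b.
Proof.
move=> bb bZ; rewrite /tlift repr_scale // scaler_sumr.
by apply: eq_bigr => p _.
Qed.

Lemma tensDl u u' v : tens (u + u') v = tens u v + tens u' v.
Proof.
apply: tensor_eq => W b bb; rewrite repr_add // /tens !tensor_reprP //.
by rewrite !big_seq1 /= balancedDl.
Qed.

Lemma tensDr u v v' : tens u (v + v') = tens u v + tens u v'.
Proof.
apply: tensor_eq => W b bb; rewrite repr_add // /tens !tensor_reprP //.
by rewrite !big_seq1 /= balancedDr.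
Qed.

Lemma tensZl a u v : tens (a *: u) v = a *: tens u v.
Proof.
apply: tensor_eq => W b bb; rewrite repr_scale // /tens tensor_reprP //.
by rewrite (tensor_reprP _ (balanced_scale a bb)) !big_seq1.
Qed.

Lemma tensZr a u v : tens u (a *: v) = a *: tens u v.
Proof.
rewrite -tensZl; apply: tensor_eq => W b bb; rewrite /tens !tensor_reprP //.
by rewrite !big_seq1 /= balancedZ.
Qed.

Lemma tens_suml I (r : seq I) (P : pred I) (F : I -> U) v :
  tens (\sum_(i <- r | P i) F i) v = \sum_(i <- r | P i) tens (F i) v.
Proof.
apply: (big_morph (tens^~ v)) => [u u'|]; first exact: tensDl.
by rewrite -(scale0r 0) tensZl scale0r.
Qed.

Lemma tens_sumr I (r : seq I) (P : pred I) u (F : I -> V) :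
  tens u (\sum_(i <- r | P i) F i) = \sum_(i <- r | P i) tens u (F i).
Proof.
apply: (big_morph (tens u)) => [v v'|]; first exact: tensDr.
by rewrite -(scale0r 0) tensZr scale0r.
Qed.

Lemma balanced_tens : balanced tens.
Proof.
split; [exact: tensDl | exact: tensDr|].
by move=> a u v; rewrite tensZl tensZr.
Qed.

Lemma tensorE (t : tensor) : t = \sum_(p <- repr t) tens p.1 p.2.
Proof.
apply: tensor_eq => W b bb; rewrite -!/(tlift _ b) tlift_sum //.
by apply: eq_bigr => p _; rewrite tlift_tens.
Qed.

Lemma tensor_ext (W : zmodType) (f g : {additive tensor -> W}) :
  (forall u v, f (tens u v) = g (tens u v)) -> f =1 g.
Proof.
move=> fg t; rewrite [t]tensorE !raddf_sum.
by apply: eq_bigr => p _.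
Qed.

End Tensor.

Notation "U ⊗ V" := (tensor U V) : type_scope.
Notation "u ⊗ v" := (tens u v) : ring_scope.
Notation "\tsum_ ( x , y <- t ) F" := (tlift t (fun x y => F)) : ring_scope.

Definition tmap (R : comNzRingType) (U U' V V' : lmodType R)
    (f : U -> U') (g : V -> V') (t : U ⊗ V) : U' ⊗ V' :=
  \tsum_(x, y <- t) (f x ⊗ g y).

HB.mixin Record isCoalgebra (R : comNzRingType) C of GRing.Lmodule R C := {
  comul : {linear C -> (C ⊗ C)%type};
  counit : {scalar C};
  comulA : forall c : C,
    \tsum_(x, y <- comul c) \tsum_(x1, x2 <- comul x) (x1 ⊗ (x2 ⊗ y))
    = \tsum_(x, y <- comul c) (x ⊗ comul y);
  counitl : forall c : C, \tsum_(x, y <- comul c) (counit x *: y) = c;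
  counitr : forall c : C, \tsum_(x, y <- comul c) (counit y *: x) = c
}.

#[short(type="coalgType")]
HB.structure Definition Coalgebra (R : comNzRingType) :=
  {C of GRing.Lmodule R C & isCoalgebra R C}.

HB.mixin Record isBialgebra (R : comNzRingType) H
    of GRing.Algebra R H & isCoalgebra R H := {
  comul1 : comul (1 : H) = 1 ⊗ 1;
  comulM : forall x y : H, comul (x * y) =
    \tsum_(x1, x2 <- comul x) \tsum_(y1, y2 <- comul y)
      ((x1 * y1) ⊗ (x2 * y2));
  counit1 : counit (1 : H) = 1;
  counitM : forall x y : H, counit (x * y) = counit x * counit y
}.

#[short(type="bialgType")]
HB.structure Definition Bialgebra (R : comNzRingType) :=
  {H of GRing.Algebra R H & isCoalgebra R H & isBialgebra R H}.

HB.mixin Record hasAntipode (R : comNzRingType) H of Bialgebra R H := {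
  antipode : {linear H -> H};
  antipodel : forall h : H,
    \tsum_(x, y <- comul h) (antipode x * y) = (counit h)%:A;
  antipoder : forall h : H,
    \tsum_(x, y <- comul h) (x * antipode y) = (counit h)%:A
}.

#[short(type="hopfType")]
HB.structure Definition Hopf (R : comNzRingType) :=
  {H of Bialgebra R H & hasAntipode R H}.

HB.mixin Record hasCirc (K : numClosedFieldType) C of Coalgebra K C := {
  circ : {linear C -> C | Num.conj \; *:%R};
  circK : involutive circ;
  comul_circ : forall c : C,
    comul (circ c) = \tsum_(x, y <- comul c) (circ y ⊗ circ x)
}.

#[short(type="circCoalgType")]
HB.structure Definition CircCoalgebra (K : numClosedFieldType) :=
  {C of Coalgebra K C & hasCirc K C}.

HB.mixin Record isCircHopf (K : numClosedFieldType) H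
    of Hopf K H & hasCirc K H := {
  circM : forall x y : H, circ (x * y) = circ x * circ y
}.

#[short(type="circHopfType")]
HB.structure Definition CircHopf (K : numClosedFieldType) :=
  {H of Hopf K H & hasCirc K H & isCircHopf K H}.

Section Comodules.
Variables (R : comNzRingType) (C : coalgType R).

Record is_comodule (V : lmodType R) (chi : {linear V -> (V ⊗ C)%type}) : Prop :=
  IsComodule {
  coactA : forall v,
    \tsum_(x, h <- chi v) \tsum_(y, g <- chi x) (y ⊗ (g ⊗ h))
    = \tsum_(x, h <- chi v) (x ⊗ comul h);
  coact_counit : forall v, \tsum_(x, h <- chi v) (counit h *: x) = v
}.

Definition comodule_morphism (V W : lmodType R)
    (chi : V -> V ⊗ C) (psi : W -> W ⊗ C) (phi : {linear V -> W}) : Prop :=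
  forall v, psi (phi v) = tmap phi idfun (chi v).

Definition comodule_isomorphism (V W : lmodType R)
    (chi : V -> V ⊗ C) (psi : W -> W ⊗ C) (phi : {linear V -> W}) : Prop :=
  comodule_morphism chi psi phi /\ bijective phi.

End Comodules.

Section DualComodule.
Variables (K : fieldType) (H : hopfType K) (V : vectType K).
Variable chi : {linear V -> (V ⊗ H)%type}.

Local Notation dual := 'Hom(V, K^o).

(* [Σ f(v_0) S(v_1)] *)
Definition dual_pairing (f : dual) (v : V) : H :=
  \tsum_(x, h <- chi v) ((f x : K) *: antipode h).

Definition dual_basis (i : 'I_(\dim {:V})) : dual :=
  linfun (coord (vbasis {:V}) i : V -> K^o).

(* The map [f |-> Σ f_0 ⊗ f_1] on the dual determined by                      *)
(* [Σ f_0(v) f_1 = Σ f(v_0) S(v_1)], written out in a basis of V;             *)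
(* see [dual_coactP] and [dual_coact_unique].                                 *)
Definition dual_coact (f : dual) : dual ⊗ H :=
  \sum_i (dual_basis i ⊗ dual_pairing f (vbasis {:V})`_i).

Lemma balanced_dual_pairing (f : dual) :
  balanced (fun (x : V) (h : H) => (f x : K) *: antipode h).
Proof.
split=> [u u' v|u v v'|a u v].
- by rewrite linearD scalerDl.
- by rewrite linearD scalerDr.
- by rewrite !linearZ /= scalerA; congr (_ *: _); apply: mulrC.
Qed.

Lemma balanced_eval (v : V) : balanced (fun (g : dual) (h : H) => (g v : K) *: h).
Proof.
split=> [u u' w|u w w'|a u w].
- by rewrite lfunE /= scalerDl.
- by rewrite scalerDr.
- by rewrite lfunE /= scalerA [X in _ = X *: _]mulrC.
Qed.

Lemma dual_pairing_is_linear (f : dual) : linear (dual_pairing f).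
Proof.
move=> a u v; rewrite /dual_pairing linearP.
rewrite (tlift_is_additive _ _ (balanced_dual_pairing f)).
rewrite (tliftZ _ (balanced_dual_pairing f)) // => x h.
by rewrite linearZ /= scalerA.
Qed.

HB.instance Definition _ (f : dual) :=
  GRing.isLinear.Build K V H _ (dual_pairing f) (dual_pairing_is_linear f).

Lemma dual_coact_is_linear : linear dual_coact.
Proof.
move=> a f g; rewrite /dual_coact scaler_sumr -big_split; apply: eq_bigr => i _.
rewrite /= -tensZr -tensDr; congr (_ ⊗ _).
rewrite /dual_pairing /tlift scaler_sumr -big_split; apply: eq_bigr => p _.
by rewrite !lfunE /= lfunE /= scalerDl scalerA.
Qed.

HB.instance Definition _ :=
  GRing.isLinear.Build K dual (dual ⊗ H)%type _ dual_coact dual_coact_is_linear.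

Lemma dual_coactP (f : dual) (v : V) :
  \tsum_(g, h <- dual_coact f) ((g v : K) *: h)
  = \tsum_(x, h <- chi v) ((f x : K) *: antipode h).
Proof.
rewrite (tlift_sum _ _ _ (balanced_eval v)).
rewrite -[RHS]/(dual_pairing f v) [in RHS](coord_vbasis (memvf v)) linear_sum.
apply: eq_bigr => i _; rewrite (tlift_tens _ _ (balanced_eval v)) linearZ /=.
by rewrite /dual_basis lfunE.
Qed.

Lemma dual_coact_unique (t t' : dual ⊗ H) :
  (forall v, \tsum_(g, h <- t) ((g v : K) *: h) = \tsum_(g, h <- t') ((g v : K) *: h)) ->
  t = t'.
Proof.
have E (s : dual ⊗ H) : s = \sum_i (dual_basis i ⊗
    \tsum_(g, h <- s) ((g (vbasis {:V})`_i : K) *: h)).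
  rewrite {1}[s]tensorE /tlift.
  under [RHS]eq_bigr => i _ do rewrite tens_sumr.
  rewrite exchange_big; apply: eq_bigr => -[g h] _ /=.
  under eq_bigr => i _ do rewrite tensZr -tensZl.
  rewrite -tens_suml; congr (_ ⊗ _); apply/lfunP => v.
  rewrite {1}(coord_vbasis (memvf v)) linear_sum sum_lfunE; apply: eq_bigr => i _.
  by rewrite linearZ /= lfunE /= /dual_basis lfunE /= [LHS]mulrC.
by move=> tt'; rewrite [t]E [t']E; apply: eq_bigr => i _; rewrite tt'.
Qed.

End DualComodule.

Section Unitary.
Variables (K : numClosedFieldType) (H : circCoalgType K) (V : lmodType K).

Definition unitary (chi : V -> V ⊗ H) (beta : {dot V for Num.conj}) : Prop :=
  forall u v,
    \tsum_(x, h <- chi u) (beta x v *: h)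
    = \tsum_(x, h <- chi v) (beta u x *: circ h).

Definition positive_definite_map (beta : {dot V for Num.conj}) (phi : V -> V) :=
  forall v, v != 0 -> 0 < beta (phi v) v.

End Unitary.

(* Main.v *)
(* The inner products give conjugate linear maps J : V -> V^* and             *)
(* J' : V^* -> V^**. Unitarity says that J and J' intertwine the coactions up *)
(* to h |-> S(h°), so J'J intertwines χ with the coaction of V^**, which is   *)
(* (id ⊗ S²)χ under V = V^**, because S(S(h°)°) = h. For the latter,          *)
(* Σ (S(h_2°))° h_1 = ε(h)1, and antimultiplicativity of S turns this into    *)
(* Σ S(h_1) S((S(h_2°))°) = ε(h)1. Finally β(J'Jv, v) = β'(Jv, Jv) > 0.       *)
Require Import Defs.
From HB Require Import structures.
From mathcomp Require Import all_boot all_order all_algebra.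
From mathcomp Require Import reals complex.

Set Implicit Arguments.
Unset Strict Implicit.
Unset Printing Implicit Defensive.

Import GRing.Theory Num.Theory.
Local Open Scope ring_scope.

(** An inner product identifies a space with its dual conjugate linearly. Doing this for V and then
    for V^* gives a linear map V -> V^** = V, [biriesz], with f([biriesz] v) = β'(f, [riesz] v) for
    every functional f ([biriesz_dual]). Taking f = [riesz] v gives positivity, hence bijectivity.
    Each identification turns a coefficient h into S(h°) ([dual_coact_riesz]), and S∘S∘ = id
    ([antipode_circ_antipode_circ]) makes the two twists cancel up to S² ([biriesz_morphism]). *)

(** * Calculus of Sweedler sums *)

Section TensorLift.
Variables (R : comNzRingType) (U V : lmodType R).
Implicit Type t : (U ⊗ V)%type.

Lemma eq_tlift (W : zmodType) t (b b' : U -> V -> W) :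
  (forall x y, b x y = b' x y) -> tlift t b = tlift t b'.
Proof. by move=> bb'; apply: eq_bigr => p _. Qed.

Lemma raddf_tlift (W W' : zmodType) (g : {additive W -> W'}) t
    (b : U -> V -> W) :
  g (tlift t b) = tlift t (fun x y => g (b x y)).
Proof. exact: raddf_sum. Qed.

Lemma tlift_tlift (U' V' : lmodType R) (W : zmodType) t
    (g : U -> V -> U' ⊗ V') (b : U' -> V' -> W) : balanced b ->
  tlift (tlift t g) b = tlift t (fun x y => tlift (g x y) b).
Proof. by move=> bb; rewrite /tlift -tlift_sum. Qed.

Lemma exchange_tlift (U' V' : lmodType R) (W : zmodType) t (t' : (U' ⊗ V')%type)
    (b : U -> V -> U' -> V' -> W) :
  tlift t (fun x y => tlift t' (b x y))
  = tlift t' (fun x' y' => tlift t (fun x y => b x y x' y')).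
Proof. exact: exchange_big. Qed.

Definition bilinear_map (W : lmodType R) (b : U -> V -> W) : Prop :=
  (forall y, linear (b^~ y)) /\ (forall x, linear (b x)).

Lemma bilinear_balanced (W : lmodType R) (b : U -> V -> W) :
  bilinear_map b -> balanced b.
Proof.
case=> bl br.
have b0l y : b 0 y = 0.
  by have := bl y (-1) 0 0; rewrite scaler0 addr0 scaleN1r addNr.
have b0r x : b x 0 = 0.
  by have := br x (-1) 0 0; rewrite scaler0 addr0 scaleN1r addNr.
split=> [u u' v|u v v'|a u v].
- by have := bl v 1 u u'; rewrite !scale1r.
- by have := br u 1 v v'; rewrite !scale1r.
- have := bl v a u 0; rewrite b0l !addr0 => ->.
  by have := br u a v 0; rewrite b0r !addr0 => ->.
Qed.

Lemma tlift_linearl (W : lmodType R) (b : U -> V -> W) :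
  bilinear_map b -> linear (fun t => tlift t b).
Proof.
move=> bb a t t'; have bal := bilinear_balanced bb.
rewrite tlift_is_additive // tliftZ // => u v.
by have := bb.1 v a u 0; rewrite !addr0 (balanced0l v bal) addr0.
Qed.

Lemma tlift_linearr (E W : lmodType R) (b : E -> U -> V -> W) t :
  (forall x y, linear (fun e => b e x y)) -> linear (fun e => tlift t (b e)).
Proof.
move=> lb a e e'; rewrite /tlift scaler_sumr -big_split.
by apply: eq_bigr => p _; apply: lb.
Qed.

Lemma tlift_mull (A : pzRingType) t a (b : U -> V -> A) :
  tlift t (fun x y => a * b x y) = a * tlift t b.
Proof. by rewrite /tlift mulr_sumr. Qed.

Lemma tlift_mulr (A : pzRingType) t a (b : U -> V -> A) :
  tlift t (fun x y => b x y * a) = tlift t b * a.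
Proof. by rewrite /tlift mulr_suml. Qed.

End TensorLift.

(** * Coassociativity and counit inside multilinear expressions *)

Section Coalgebra.
Variables (R : comNzRingType) (C : coalgType R) (W : lmodType R).

(** A trilinear f factors through C ⊗ (C ⊗ C), so it can be applied to both sides of [comulA]. *)
Lemma comul_coassoc (f : C -> C -> C -> W) c :
    (forall y z, linear (fun x => f x y z)) ->
    (forall x z, linear (fun y => f x y z)) ->
    (forall x y, linear (f x y)) ->
  \tsum_(x, y <- comul c) \tsum_(x1, x2 <- comul x) f x1 x2 y
  = \tsum_(x, y <- comul c) \tsum_(y1, y2 <- comul y) f x y1 y2.
Proof.
move=> f1 f2 f3.
have bf x : balanced (f x) by apply: bilinear_balanced; split.
have bF : balanced (fun x (t : (C ⊗ C)%type) => tlift t (f x)).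
  apply: bilinear_balanced; split=> [t|x]; last by apply: tlift_linearl; split.
  exact: tlift_linearr.
have := congr1 (fun t => tlift t (fun x u => tlift u (f x))) (comulA c).
rewrite !tlift_tlift // => E.
transitivity (\tsum_(x, y <- comul c)
    tlift (\tsum_(x1, x2 <- comul x) (x1 ⊗ (x2 ⊗ y))) (fun x u => tlift u (f x))).
  apply: eq_tlift => x y; rewrite tlift_tlift //; apply: eq_tlift => x1 x2.
  by rewrite !tlift_tens.
by rewrite E; apply: eq_tlift => x y; rewrite tlift_tens.
Qed.

Lemma counitl_map (g : C -> W) c : linear g ->
  \tsum_(x, y <- comul c) (counit x *: g y) = g c.
Proof.
move=> lg; pose gL : {linear C -> W} := HB.pack g (GRing.isLinear.Build _ _ _ _ g lg).
rewrite -[in RHS](counitl c) -[g]/(gL : C -> W) raddf_tlift.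
by apply: eq_tlift => x y; rewrite -(linearZ_LR gL).
Qed.

Lemma counitr_map (g : C -> W) c : linear g ->
  \tsum_(x, y <- comul c) (counit y *: g x) = g c.
Proof.
move=> lg; pose gL : {linear C -> W} := HB.pack g (GRing.isLinear.Build _ _ _ _ g lg).
rewrite -[in RHS](counitr c) -[g]/(gL : C -> W) raddf_tlift.
by apply: eq_tlift => x y; rewrite -(linearZ_LR gL).
Qed.

End Coalgebra.

Ltac prove_linear := by move=> a u v /=;
  rewrite !(linearP, mulrDl, mulrDr, =^~ scalerAl, =^~ scalerAr).

(** * The antipode is antimultiplicative *)

Section Antipode.
Variables (R : comNzRingType) (H : hopfType R).
Implicit Types x y : H.
Local Notation S := (antipode : H -> H).

Lemma antipode1 : S 1 = 1.
Proof.
have := antipodel (1 : H); rewrite comul1 tlift_tens.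
  by rewrite mulr1 counit1 scale1r.
by apply: bilinear_balanced; split=> ?; prove_linear.
Qed.

(* S(xy) is a left and S(y)S(x) a right convolution inverse of the            *)
(* multiplication H ⊗ H -> H.                                                 *)
Lemma antipodeM x y : S (x * y) = S y * S x.
Proof.
have mulS : balanced (fun a b : H => S a * b).
  by apply: bilinear_balanced; split=> ?; prove_linear.
(* The convolution product of both inverses with the multiplication between them. [Q1] cancels y2
   against S(y3); [Q2] regroups so that S(x1 y1) meets x2 y2. *)
pose Q x1 x2 x3 := \tsum_(y1, y' <- comul y) \tsum_(y2, y3 <- comul y')
  (S (x1 * y1) * (x2 * (y2 * S y3) * S x3)).
have Q1 x1 x2 x3 : Q x1 x2 x3 = S (x1 * y) * (x2 * S x3).
  transitivity (\tsum_(y1, y' <- comul y)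
      (counit y' *: (S (x1 * y1) * (x2 * S x3)))); last first.
    by apply: counitr_map => //; prove_linear.
  apply: eq_tlift => y1 y'; rewrite tlift_mull tlift_mulr tlift_mull antipoder.
  by rewrite -scalerAr mulr1 -scalerAl -scalerAr.
have Q2 x1 x2 x3 : Q x1 x2 x3 = \tsum_(y', y3 <- comul y)
    \tsum_(y1, y2 <- comul y') (S (x1 * y1) * (x2 * y2) * (S y3 * S x3)).
  transitivity (\tsum_(y1, y' <- comul y) \tsum_(y2, y3 <- comul y')
      (S (x1 * y1) * (x2 * y2) * (S y3 * S x3))).
    by apply: eq_tlift => y1 y'; apply: eq_tlift => y2 y3; rewrite !mulrA.
  by symmetry; apply: comul_coassoc => ? ?; prove_linear.
have Q_linear : (forall x2 x3, linear (fun x1 => Q x1 x2 x3)) /\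
    (forall x1 x3, linear (fun x2 => Q x1 x2 x3)) /\
    (forall x1 x2, linear (Q x1 x2)).
  by split; [|split] => ? ? a u v; rewrite !Q1; move: a u v; prove_linear.
transitivity (\tsum_(x1, x' <- comul x) \tsum_(x2, x3 <- comul x') Q x1 x2 x3).
  transitivity (\tsum_(x1, x' <- comul x) (counit x' *: S (x1 * y))).
    by rewrite counitr_map //; prove_linear.
  apply: eq_tlift => x1 x'; under [RHS]eq_tlift => x2 x3 do rewrite Q1.
  by rewrite tlift_mull antipoder -scalerAr mulr1.
rewrite -comul_coassoc; [|exact: Q_linear.1|exact: Q_linear.2.1|exact: Q_linear.2.2].
transitivity (\tsum_(x', x3 <- comul x) \tsum_(y', y3 <- comul y)
    (counit x' *: (counit y' *: (S y3 * S x3)))).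
  apply: eq_tlift => x' x3; under eq_tlift => x1 x2 do rewrite Q2.
  rewrite exchange_tlift; apply: eq_tlift => y' y3.
  under eq_tlift => x1 x2 do rewrite tlift_mulr.
  (* The two counits combine into that of x' * y', to which the left antipode law applies. *)
  rewrite tlift_mulr scalerA -counitM -mulr_algl -antipodel comulM.
  rewrite tlift_tlift //; congr (_ * _).
  apply: eq_tlift => x1 x2; rewrite tlift_tlift //; apply: eq_tlift => y1 y2.
  by rewrite tlift_tens.
rewrite -[RHS](@counitl_map _ _ _ (fun x => S y * S x)); last by prove_linear.
apply: eq_tlift => x' x3.
rewrite -[in RHS](@counitl_map _ _ _ (fun y => S y * S x3)); last by prove_linear.
by rewrite /tlift scaler_sumr.
Qed.

End Antipode.

(** * The involution, the counit and the inverse of the antipode *)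

Section Circ.
Variables (K : numClosedFieldType) (H : circHopfType K).
Implicit Types h : H.
Local Notation S := (antipode : H -> H).

Lemma circ1 : circ (1 : H) = 1.
Proof. by have := circM (circ 1) (1 : H); rewrite mulr1 circK mul1r => <-. Qed.

Lemma circZ a h : circ (a *: h) = a^* *: circ h.
Proof. exact: linearZ. Qed.

Lemma comul_circ_tlift (W : lmodType K) (b : H -> H -> W) h : bilinear_map b ->
  tlift (comul (circ h)) b = \tsum_(x, y <- comul h) b (circ y) (circ x).
Proof.
move=> bb; have bal := bilinear_balanced bb.
rewrite comul_circ tlift_tlift //; apply: eq_tlift => x y.
by rewrite tlift_tens.
Qed.

(** Since ° flips the coproduct, h |-> conj(ε(h°)) is a right counit; it agrees with the left counit
    ε. *)
Lemma counit_circ h : counit (circ h) = (counit h)^*.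
Proof.
have E : \tsum_(x, y <- comul h) ((counit (circ y))^* *: x) = h.
  rewrite -[RHS]circK -[circ h in RHS](counitl (circ h)) comul_circ_tlift.
    rewrite raddf_tlift; apply: eq_tlift => x y.
    by rewrite /= circZ circK.
  by split=> ? a u v /=; rewrite ?linearP ?scalerDl ?scalerDr ?scalerA // mulrC.
suff -> : counit h = (counit (circ h))^* by rewrite conjCK.
rewrite -{1}E raddf_tlift -[in RHS](counitl h) !raddf_tlift.
apply: eq_tlift => x y.
by rewrite /= circZ !linearZ /= rmorphM /= conjCK mulrC.
Qed.

Let T h := circ (S (circ h)).

Lemma circ_antipode_circ_linear : linear T.
Proof.
move=> a u v; rewrite /T linearD circZ linearP raddfD /=.
by rewrite circZ conjCK.
Qed.

(** This is the left antipode law for h° with ° applied: products keep their order, while the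
    coproduct is flipped. *)
Lemma circ_antipode_circl h : \tsum_(x, y <- comul h) (T y * x) = (counit h)%:A.
Proof.
transitivity (circ (\tsum_(x, y <- comul (circ h)) (S x * y))).
  rewrite comul_circ_tlift; last by split=> ?; prove_linear.
  by rewrite raddf_tlift; apply: eq_tlift => x y; rewrite /= circM circK.
by rewrite antipodel circZ circ1 counit_circ conjCK.
Qed.

(** Evaluate Σ h_1 S(h_2) S(T(h_3)) in two ways: the first two factors collapse to leave S(T(h)),
    the last two are S(T(h_3) h_2) and collapse to leave h. *)
Lemma antipode_circ_antipode_circ h : S (circ (S (circ h))) = h.
Proof.
have TP := circ_antipode_circ_linear.
transitivity (\tsum_(x, y <- comul h) \tsum_(x1, x2 <- comul x)
    (x1 * S x2 * S (T y))).
  rewrite -[LHS](@counitl_map _ _ _ (S \o T)) => [|a u v /=]; last by rewrite TP linearP.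
  by apply: eq_tlift => x y; rewrite tlift_mulr antipoder mulr_algl.
rewrite comul_coassoc => [|y z|x z|x y]; try prove_linear; last first.
  by move=> a u v; rewrite TP linearP mulrDr -scalerAr.
rewrite -[RHS](counitr h); apply: eq_tlift => x y.
under eq_tlift => y1 y2 do rewrite -mulrA -antipodeM.
rewrite tlift_mull -(raddf_tlift (antipode : {linear H -> H})).
rewrite circ_antipode_circl -[X in _ * X]/(S _) linearZ antipode1 /=.
by rewrite -scalerAr mulr1.
Qed.

End Circ.

(** * Functionals on V separate V ⊗ W *)

Section DualSeparation.
Variables (K : fieldType) (V : vectType K) (W : lmodType K).

Lemma tensor_vect_eq (t t' : (V ⊗ W)%type) :
  (forall f : 'Hom(V, K^o), \tsum_(x, w <- t) ((f x : K) *: w)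
                          = \tsum_(x, w <- t') ((f x : K) *: w)) ->
  t = t'.
Proof.
have E (s : (V ⊗ W)%type) : s = \sum_(i < \dim {:V}) ((vbasis {:V})`_i ⊗
    \tsum_(x, w <- s) ((dual_basis i x : K) *: w)).
  rewrite {1}[s]tensorE /tlift.
  under [RHS]eq_bigr => i _ do rewrite tens_sumr.
  rewrite exchange_big; apply: eq_bigr => -[x w] _ /=.
  under eq_bigr => i _ do rewrite tensZr -tensZl.
  rewrite -tens_suml; congr (_ ⊗ _).
  rewrite {1}(coord_vbasis (memvf x)); apply: eq_bigr => i _.
  by rewrite /dual_basis lfunE.
by move=> tt'; rewrite [t]E [t']E; apply: eq_bigr => i _; rewrite tt'.
Qed.

End DualSeparation.

(** * The positive definite map V -> V^** = V *)

Section DoubleDual.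
Variables (K : numClosedFieldType) (V : vectType K).
Local Notation dual := 'Hom(V, K^o).
Variables (beta : {dot V for Num.conj}) (beta' : {dot dual for Num.conj}).

Definition riesz (v : V) : dual := linfun (applyr beta v : V -> K^o).

Lemma rieszE v x : riesz v x = beta x v.
Proof. by rewrite /riesz lfunE. Qed.

Lemma rieszP a u v : riesz (a *: u + v) = a^* *: riesz u + riesz v.
Proof.
by apply/lfunP => x; rewrite add_lfunE scale_lfunE !rieszE linearPr.
Qed.

(* The composite of V -> V^*, V^* -> V^** induced by the two inner products   *)
(* and the inverse of the canonical isomorphism V -> V^**; see [biriesz_dual]. *)
Definition biriesz (v : V) : V :=
  \sum_(i < \dim {:V}) beta' (dual_basis i) (riesz v) *: (vbasis {:V})`_i.

Lemma dual_eq_sum (f : dual) :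
  f = \sum_(i < \dim {:V}) (f (vbasis {:V})`_i : K) *: dual_basis i.
Proof.
apply/lfunP => v; rewrite {1}(coord_vbasis (memvf v)) linear_sum sum_lfunE.
apply: eq_bigr => i _.
by rewrite linearZ lfunE /= /dual_basis lfunE [LHS]mulrC.
Qed.

Lemma biriesz_dual (f : dual) v : f (biriesz v) = beta' f (riesz v).
Proof.
rewrite [f in RHS]dual_eq_sum -applyrE linear_sum linear_sum /=.
by apply: eq_bigr => i _; rewrite linearZ_LR [LHS]mulrC linearZl_LR.
Qed.

Lemma biriesz_is_linear : linear biriesz.
Proof.
move=> a u v; rewrite /biriesz scaler_sumr -big_split; apply: eq_bigr => i _ /=.
by rewrite rieszP linearPr /= conjCK scalerDl scalerA.
Qed.

HB.instance Definition _ :=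
  GRing.isLinear.Build K V V _ biriesz biriesz_is_linear.

(** β([biriesz] v, v) = β'([riesz] v, [riesz] v), and [riesz] is injective because β(v, v) > 0 for v
    nonzero. *)
Lemma biriesz_positive : positive_definite_map beta biriesz.
Proof.
move=> v v0; rewrite -rieszE biriesz_dual neq0_dnorm_gt0 //.
apply: contra_neq v0 => rv0; apply/eqP; rewrite -[_ == 0](dnorm_eq0 beta).
by rewrite -rieszE rv0 lfunE.
Qed.

(** Positivity forces a zero kernel, which suffices in finite dimension. *)
Lemma biriesz_bij : bijective biriesz.
Proof.
have k0 : lker (linfun biriesz) == 0%VS.
  rewrite -subv0; apply/subvP => v; rewrite memv_ker memv0 lfunE /=.
  apply: contraTT => v0; apply/eqP => pv0.
  by have := biriesz_positive v0; rewrite pv0 linear0l Order.POrderTheory.ltxx.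
exists (linfun biriesz)^-1%VF => v.
  by rewrite -[biriesz v]lfunE lker0_lfunK.
by rewrite -[biriesz _]lfunE lker0_lfunVK.
Qed.

End DoubleDual.

(** * Compatibility with the coactions *)

Section Unitary.
Variables (K : numClosedFieldType) (H : circHopfType K) (V : vectType K).
Variable chi : {linear V -> (V ⊗ H)%type}.
Variables (beta : {dot V for Num.conj}) (beta' : {dot 'Hom(V, K^o) for Num.conj}).
Local Notation S := (antipode : H -> H).

(** Both factors are conjugate linear, so scalars pass from one to the other. *)
Lemma balanced_dot_circ (U : lmodType K) (gamma : {dot U for Num.conj}) u :
  balanced (fun (x : U) (h : H) => gamma u x *: circ h).
Proof.
split=> [x y h|x h h'|a x h].
- by rewrite linearDr scalerDl.
- by rewrite linearD scalerDr.
- by rewrite circZ linearZr_LR scalerA [in RHS]mulrC.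
Qed.

(** Evaluated at u, this is S applied to the unitarity identity for u and v. *)
Lemma dual_coact_riesz v : unitary chi beta ->
  dual_coact chi (riesz beta v)
  = \tsum_(x, h <- chi v) (riesz beta x ⊗ S (circ h)).
Proof.
move=> hbeta; apply: dual_coact_unique => u; rewrite dual_coactP.
rewrite tlift_tlift; last exact: balanced_eval.
transitivity (S (\tsum_(x, h <- chi u) (beta x v *: h))).
  by rewrite raddf_tlift; apply: eq_tlift => x h; rewrite /= linearZ rieszE.
rewrite hbeta raddf_tlift; apply: eq_tlift => x h.
rewrite tlift_tens; last exact: balanced_eval.
by rewrite /= linearZ rieszE.
Qed.

Lemma biriesz_morphism :
  unitary chi beta -> unitary (dual_coact chi) beta' ->
  comodule_morphism chi (tmap idfun (S \o S) \o chi) (biriesz beta beta').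
Proof.
move=> hbeta hbeta' v; apply: tensor_vect_eq => f /=.
have ev : balanced (fun (x : V) (h : H) => (f x : K) *: h).
  apply: bilinear_balanced; split=> [h|x] a u w /=.
    by rewrite linearP scalerDl scalerA.
  by rewrite scalerDr !scalerA mulrC.
rewrite /tmap !tlift_tlift //.
(* One S of S² is absorbed into the dual coaction of f; unitarity of β' then moves that coaction
   onto [riesz] v. *)
transitivity (S (\tsum_(g, h <- dual_coact chi f) (beta' g (riesz beta v) *: h))).
  transitivity (S (\tsum_(g, h <- dual_coact chi f)
      ((g (biriesz beta beta' v) : K) *: h))).
    rewrite dual_coactP raddf_tlift; apply: eq_tlift => x h.
    by rewrite tlift_tens //= linearZ.
  by congr (S _); apply: eq_tlift => g h; rewrite biriesz_dual.
have bal := balanced_dot_circ beta' f.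
rewrite hbeta' dual_coact_riesz // tlift_tlift //.
rewrite raddf_tlift; apply: eq_tlift => x h.
rewrite !tlift_tens //= -/(S _) linearZ /=.
by rewrite antipode_circ_antipode_circ biriesz_dual.
Qed.

End Unitary.

Theorem theorem5p5 (R : realType) (H : circHopfType R[i]) (V : vectType R[i])
    (chi : {linear V -> (V ⊗ H)%type}) (hchi : is_comodule chi)
    (beta : {dot V for Num.conj}) (hbeta : unitary chi beta)
    (hdual : exists beta' : {dot 'Hom(V, R[i]^o) for Num.conj},
       unitary (dual_coact chi) beta') :
  exists phi : {linear V -> V},
    comodule_isomorphism chi
      (tmap idfun ((antipode : H -> H) \o (antipode : H -> H)) \o chi) phi
    /\ positive_definite_map beta phi.
Proof.
have [beta' hbeta'] := hdual; exists (biriesz beta beta').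
split; last exact: biriesz_positive.
by split; [exact: biriesz_morphism | exact: biriesz_bij].
Qed.
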